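(* Let $g\ge3$ and $2\le k<g$ be integers such that the $(g,k)$ Young graph exists. Then the $(g,k)$ Young graph is a complete graph $K_m$ (for some $m$) if and only if every non-starting node of it has a label of the form $[r,r]$.
   Context: Notation: $(a_{n-1},\dots,a_1,a_0)_g$ denotes $\sum_{i=0}^{n-1}a_ig^i$ with digits $0\le a_i<g$. A positive integer $N=(a_{n-1},\dots,a_0)_g$ with $a_{n-1}\neq 0$ is a $(g,k)$-reverse multiple if $kN=(a_0,a_1,\dots,a_{n-1})_g$. Young graph. The directed edge-labelled graph $H(g,k)$ is defined as follows. Its possible nodes are a distinguished starting node, written $[[0,0]]$, and ordered pairs $[s,r]$ of integers with $0\le s,r\le k-1$ (the pair $[0,0]$ is a node distinct from the starting node). For a node $[s,r]$ (the starting node being treated as $s=r=0$) and each pair of digits $(c,a)$, $0\le a,c\le g-1$, with $ka+r\equiv c \pmod g$ and $0\le a+sg-kc\le k-1$, there is a directed edge labelled $(c,a)$ from $[s,r]$ to the node $[\,a+sg-kc,\ (ka+r-c)/g\,]$; for edges leaving the starting node one additionally requires $a\ne0$ and $c\ne0$. $H(g,k)$ consists of the starting node, the nodes reachable from it by directed paths, and all edges leaving these nodes. A non-starting node of the form $[r,r]$ ($r\ge0$, including $[0,0]$) is an even pivot node; a non-starting node is an odd pivot node if it is of the form $[r,r]$ and carries a loop, or is of the form $[r',r]$ with $r'\ne r$ and has an edge to $[r,r']$. The $(g,k)$ Young graph exists if $H(g,k)$ contains a node $[r,r]$ with $r\ne0$ or an edge $[r',r]\to[r,r']$ with $r'\ne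 r$; it is then obtained from $H(g,k)$ by deleting every node from which no pivot node can be reached by a directed path, together with all edges incident to such nodes. Complete graph $K_m$: a Young graph is the complete graph $K_m$ if it has exactly $m$ non-starting nodes, there is a directed edge from every non-starting node to every non-starting node (including a loop at each non-starting node, $m^2$ edges in all), and the starting node has an edge to every non-starting node except $[0,0]$. *)

(* Defs.v *)
From mathcomp Require Import all_boot.

Set Implicit Arguments.
Unset Strict Implicit.
Unset Printing Implicit Defensive.

(* [None] is the starting node [[0,0]]; [Some (s, r)] is the node [s,r], so
   [Some (0, 0)] is the node [0,0], distinct from the starting node. *)
Definition ynode (k : nat) : finType := option ('I_k * 'I_k)%type.

Definition start_node {k : nat} : ynode k := None.

(* The starting node carries s = r = 0. *)
Definition node_s {k : nat} (x : ynode k) : nat :=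
  if x is Some p then p.1 else 0.

Definition node_r {k : nat} (x : ynode k) : nat :=
  if x is Some p then p.2 else 0.

(* A label (c, a) is a pair of base-g digits. *)
Definition ylabel (g : nat) : finType := ('I_g * 'I_g)%type.

(* [hedge x (c, a) [s', r']] says s' = a + s g - k c and r' = (k a + r - c) / g,
   written without the truncated subtraction of [nat]; the second equation
   contains the congruence k a + r = c mod g, and s' : 'I_k contains the bounds
   0 <= a + s g - k c <= k - 1.  Typing r' in 'I_k excludes no edge, since
   k a + r <= k (g - 1) + (k - 1) < k g.  No edge enters the starting node. *)
Definition hedge (g k : nat) (x : ynode k) (l : ylabel g) (y : ynode k) : bool :=
  let c : nat := l.1 in
  let a : nat := l.2 in
  if y is Some q then
    [&& q.1 + k * c == a + node_s x * g,
        g * q.2 + c == k * a + node_r x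
      & (x == start_node) ==> (a != 0) && (c != 0)]
  else false.

Definition hadj (g k : nat) : rel (ynode k) :=
  fun x y => [exists l : ylabel g, hedge x l y].

(* The nodes of H(g,k); [connect] is the reflexive-transitive closure. Every
   edge of [hedge] leaving such a node is an edge of H(g,k). *)
Definition hnode (g k : nat) (x : ynode k) : bool :=
  connect (hadj g (k := k)) start_node x.

Definition even_pivot (k : nat) (x : ynode k) : bool :=
  if x is Some p then p.1 == p.2 else false.

Definition odd_pivot (g k : nat) (x : ynode k) : bool :=
  if x is Some p then
    ((p.1 == p.2) && hadj g x x)
    || ((p.1 != p.2) && hadj g x (Some (p.2, p.1)))
  else false.

Definition pivot (g k : nat) (x : ynode k) : bool :=
  even_pivot x || odd_pivot g x.

Definition young_exists (g k : nat) : Prop :=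
  (exists r : 'I_k, (r : nat) <> 0 /\ hnode g (Some (r, r)))
  \/ (exists r' r : 'I_k, r' <> r /\ hnode g (Some (r', r)) /\
        hadj g (Some (r', r)) (Some (r, r'))).

(* Paths have length >= 0, so pivot nodes themselves are kept. *)
Definition young_node (g k : nat) (x : ynode k) : bool :=
  hnode g x && [exists y : ynode k, pivot g y && connect (hadj g (k := k)) x y].

Definition young_edge (g k : nat) (x : ynode k) (l : ylabel g) (y : ynode k) :
    bool :=
  [&& young_node g x, young_node g y & hedge x l y].

Definition young_adj (g k : nat) (x y : ynode k) : Prop :=
  exists l : ylabel g, young_edge x l y.

Record young_complete (g k m : nat) : Prop := YoungComplete {
  complete_nodes : #|[set p : 'I_k * 'I_k | young_node g (Some p)]| = m;
  complete_adj : forall p q : 'I_k * 'I_k,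
    young_node g (Some p) -> young_node g (Some q) ->
    young_adj g (Some p) (Some q);
  (* labelled edges between non-starting nodes *)
  complete_edges :
    #|[set e : ('I_k * 'I_k) * ylabel g * ('I_k * 'I_k) |
        young_edge (Some e.1.1) e.1.2 (Some e.2)]| = m ^ 2;
  complete_start : forall p : 'I_k * 'I_k,
    young_node g (Some p) ->
    (young_adj g start_node (Some p)
       <-> ~ ((p.1 : nat) = 0 /\ (p.2 : nat) = 0))
}.

(* Main.v *)
Require Import Defs.
From Stdlib Require Import ZArith.
From mathcomp Require Import all_boot zify.

Set Implicit Arguments.
Unset Strict Implicit.
Unset Printing Implicit Defensive.

(* An edge [s,r] -> [s',r'] determines its label, and the label is integral
   exactly when k^2 - 1 divides s g - k r + (k g r' - s').
   If [s,r] has a loop and an edge from the starting node, this gives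
   g r = k s and g s = k r modulo k^2 - 1, hence k s^2 = g r s = k r^2; since k
   is invertible modulo k^2 - 1, the latter divides s^2 - r^2, and as s, r < k, this forces s = r.
   Conversely, if all nodes are diagonal, induction along the paths from the
   starting node shows that k^2 - 1 divides i (g - k) for every node [i,i], and
   then all the labels required in a complete graph are integral. *)

(** Eliminating [a] leaves [(k * k - 1) * c] equal to an expression in the endpoints alone, and
    [k * k - 1] is positive. *)
Lemma edge_label_inj (g k s r s' r' c a c1 a1 : nat) : 1 < k ->
  s' + k * c = a + s * g -> g * r' + c = k * a + r ->
  s' + k * c1 = a1 + s * g -> g * r' + c1 = k * a1 + r ->
  c = c1 /\ a = a1.
Proof.
move=> k1 e1 e2 e3 e4.
have h1 : k * (k * c + a1) = k * (k * c1 + a) by congr (k * _); lia.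
have h2 : k * k * c + c1 = k * k * c1 + c by lia.
have kk : 1 < k * k by nia.
have e : c = c1.
  have h : (k * k - 1) * c = (k * k - 1) * c1.
    by rewrite !mulnBl !mul1n; nia.
  by apply/eqP; rewrite -(@eqn_pmul2l (k * k - 1)) ?subn_gt0 //; apply/eqP.
by subst c1; split; [|lia].
Qed.

Lemma start_loop_diagonalZ (g k s r c0 a0 c a : Z) :
  (2 <= k)%Z -> (0 <= s < k)%Z -> (0 <= r < k)%Z ->
  (s + k * c0 = a0)%Z -> (g * r + c0 = k * a0)%Z ->
  (s + k * c = a + s * g)%Z -> (g * r + c = k * a + r)%Z ->
  s = r.
Proof.
move=> k1 sk rk e1 e2 e3 e4.
have gr : (g * r = k * s + (k * k - 1) * c0)%Z by subst a0; lia.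
have [x gs] : exists x, (g * s = k * r + (k * k - 1) * x)%Z.
  exists (a - s - k * c0)%Z.
  have ec : (c = k * a + r - (k * s + (k * k - 1) * c0))%Z by lia.
  by subst c; lia.
have [z dz] : exists z, (s * s - r * r = (k * k - 1) * z)%Z.
  (* [k] is its own inverse modulo [k * k - 1]: multiplying [kd] by [k] and writing [k * k] as
     [1 + (k * k - 1)] gives this quotient. *)
  exists (k * (r * x - s * c0) - (s * s - r * r))%Z.
  have kd : (k * (s * s - r * r) = (k * k - 1) * (r * x - s * c0))%Z.
    have : (s * (g * r) = r * (g * s))%Z by lia.
    by rewrite gr gs; lia.
  have : (k * (k * (s * s - r * r))
    = k * ((k * k - 1) * (r * x - s * c0)))%Z by rewrite kd.
  by lia.
have hs : (0 <= s * s <= (k - 1) * (k - 1))%Z by nia.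
have hr : (0 <= r * r <= (k - 1) * (k - 1))%Z by nia.
(* Both squares lie between 0 and [(k - 1) * (k - 1)], which is less than [k * k - 1], so their
   difference is a multiple only if it is 0. *)
have z0 : z = 0%Z.
  have kk : ((k - 1) * (k - 1) < k * k - 1)%Z by lia.
  move: (k * k - 1)%Z ((k - 1) * (k - 1))%Z (s * s)%Z (r * r)%Z hs hr kk dz.
  by move=> m n u v hs hr kk dz; nia.
subst z; nia.
Qed.

Lemma start_loop_diagonal (g k s r c0 a0 c a : nat) :
  1 < k -> s < k -> r < k ->
  s + k * c0 = a0 -> g * r + c0 = k * a0 ->
  s + k * c = a + s * g -> g * r + c = k * a + r ->
  s = r.
Proof.
move=> k1 sk rk e1 e2 e3 e4.
suff : Z.of_nat s = Z.of_nat r by lia.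
by apply: (@start_loop_diagonalZ (Z.of_nat g) (Z.of_nat k) _ _ (Z.of_nat c0)
  (Z.of_nat a0) (Z.of_nat c) (Z.of_nat a)); lia.
Qed.

(** Modulo [k ^ 2 - 1], [i * g] is [i * k] and [k * k] is 1; eliminating [a] then turns [j * g] into
    [j * k]. *)
Lemma diagonal_edge_dvd (g k i j c a : nat) : 1 < k -> k < g ->
  k ^ 2 - 1 %| i * (g - k) ->
  j + k * c = a + i * g -> g * j + c = k * a + i ->
  k ^ 2 - 1 %| j * (g - k).
Proof.
move=> k1 kg /dvdnP[t ht] e1 e2.
have k2 : 1 < k ^ 2 by rewrite -mulnn; nia.
set M := k ^ 2 - 1 in ht *.
have hk : k * k = M + 1 by rewrite mulnn /M subnK // ltnW.
have M0 : 0 < M by rewrite subn_gt0.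
have hi : i * g = i * k + t * M by rewrite -ht -mulnDr subnKC // ltnW.
have h : j * g + M * (i + k * t) = j * k + M * c.
  have : k * (j + k * c) = k * (a + i * g) by rewrite e1.
  have -> : k * (j + k * c) = k * j + (k * k) * c by lia.
  have -> : k * (a + i * g) = k * a + (k * k) * i + k * t * M.
    by rewrite hi; lia.
  by rewrite hk; lia.
apply/dvdnP; exists (c - (i + k * t)).
(* With [h], this shows [i + k * t <= c], so the subtraction in the witness does not truncate. *)
have jg : j * k <= j * g by rewrite leq_mul2l (ltnW kg) orbT.
by rewrite mulnBr mulnBl -(mulnC M); lia.
Qed.

Lemma dvd_diagonal_edge (g k i j : nat) : 1 < k -> k < g -> i < k -> j < k ->
  k ^ 2 - 1 %| i * (g - k) -> k ^ 2 - 1 %| j * (g - k) ->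
  exists c a, [/\ c < g, a < g, j + k * c = a + i * g,
    g * j + c = k * a + i & 0 < j -> 0 < a /\ 0 < c].
Proof.
move=> k1 kg ik jk /dvdnP[t ht] /dvdnP[u hu].
have k2 : 1 < k ^ 2 by rewrite -mulnn; nia.
set M := k ^ 2 - 1 in ht hu.
have hk : k * k = M + 1 by rewrite mulnn /M subnK // ltnW.
have M0 : 0 < M by rewrite subn_gt0.
have gE : g = k + (g - k) by lia.
have hg0 : 0 < g - k by lia.
move: (g - k) gE ht hu hg0 => d -> ht hu d0 {kg}.
have Mk : M = (k - 1) * (k + 1) by lia.
(* Since [n <= k - 1], cancelling the factor [k - 1] of [M] bounds the quotient. *)
have bound n q : n < k -> n * d = q * M -> q * (k + 1) <= d.
  by move=> nk; rewrite Mk => e; nia.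
have bt := bound _ _ ik ht; have bu := bound _ _ jk hu.
(* These digits solve the two edge equations. With [m] the larger of [t] and [u], each is at most
   [k - 1 + m * (k + 1) <= k - 1 + d], hence below [g = k + d]. *)
exists (u + i + k * t), (t + j + k * u).
split.
- by case: (leqP u t) => h; nia.
- by case: (leqP u t) => h; nia.
- have -> : k * (u + i + k * t) = k * u + k * i + (k * k) * t by lia.
  by rewrite hk; lia.
- have -> : k * (t + j + k * u) = k * t + k * j + (k * k) * u by lia.
  by rewrite hk; lia.
- move=> j0; have u0 : 0 < u by rewrite lt0n; apply/eqP => u0; nia.
  by split; lia.
Qed.

Lemma hedgeP (g k : nat) (x : ynode k) (l : ylabel g) (q : 'I_k * 'I_k) :
  reflect [/\ q.1 + k * l.1 = l.2 + node_s x * g,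
              g * q.2 + l.1 = k * l.2 + node_r x
            & x = start_node -> 0 < l.2 /\ 0 < l.1]
          (hedge x l (Some q)).
Proof.
apply: (iffP and3P) => -[/eqP e1 /eqP e2 h]; split=> //.
- by move=> xs; move: h; rewrite xs eqxx /= -!lt0n => /andP.
- by apply/implyP => /eqP /h [a0 c0]; rewrite -!lt0n a0.
Qed.

Lemma young_node_pred {g k : nat} (x y : ynode k) :
  hnode g x -> hadj g x y -> young_node g y -> young_node g x.
Proof.
move=> hx xy /andP[_ /existsP[z /andP[pz yz]]]; rewrite /young_node hx /=.
by apply/existsP; exists z; rewrite pz (connect_trans (connect1 xy) yz).
Qed.

Lemma young_edge_inj {g k : nat} (x y : ynode k) (l l' : ylabel g) : 1 < k ->
  hedge x l y -> hedge x l' y -> l = l'.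
Proof.
case: y => // q k1 /hedgeP[e1 e2 _] /hedgeP[e3 e4 _].
have [ec ea] := edge_label_inj k1 e1 e2 e3 e4.
by case: l l' ec ea {e1 e2 e3 e4} => [c a] [c' a'] /= /val_inj -> /val_inj ->.
Qed.

Lemma diagonal_young_dvd (g k : nat) (y : ynode k) : 1 < k -> k < g ->
  (forall s r : 'I_k, young_node g (Some (s, r)) -> s = r) ->
  young_node g y -> k ^ 2 - 1 %| node_s y * (g - k).
Proof.
move=> k1 kg diag yy.
have /andP[/connectP[p]] := yy => pth yl _.
elim/last_ind: p y pth yl yy => [|p y' IHp] y.
  by move=> _ ->; rewrite mul0n dvdn0.
rewrite rcons_path last_rcons => /andP[pth e] -> {y} yy.
set x := last start_node p in e.
have hx : hnode g x by apply/connectP; exists p.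
(* A pivot reachable from the new endpoint is reachable from [x], so the diagonal hypothesis applies
   to [x] too. *)
have yx := young_node_pred hx e yy.
have xd : node_r x = node_s x.
  by case: (x) yx => [[s r] /diag ->|].
have {IHp} := IHp x pth erefl yx.
case: y' e yy => [[s r]|] /existsP[l] // /hedgeP[/= e1 e2 _] /diag sr.
subst r; rewrite xd in e2 => dv.
exact: diagonal_edge_dvd k1 kg dv e1 e2.
Qed.

(** Letting [x] be the starting node treats both kinds of edges at once; the last premise then makes
    the two digits nonzero. *)
Lemma diagonal_young_adj (g k : nat) (x : ynode k) (q : 'I_k * 'I_k) :
  1 < k -> k < g ->
  (forall s r : 'I_k, young_node g (Some (s, r)) -> s = r) ->
  young_node g x -> young_node g (Some q) ->
  (x = start_node -> 0 < q.1) -> young_adj g x (Some q).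
Proof.
move=> k1 kg diag yx yq xq.
have dx := diagonal_young_dvd k1 kg diag yx.
have dq := diagonal_young_dvd k1 kg diag yq.
have xd : node_r x = node_s x by case: (x) yx => [[s r] /diag ->|].
have qd : q.2 = q.1 by case: (q) yq => s r /diag ->.
have xk : node_s x < k by case: (x) => [[s r]|] //=; apply: ltnW.
have [c [a [cg ag e1 e2 pos]]] := dvd_diagonal_edge k1 kg xk (ltn_ord q.1) dx dq.
exists (Ordinal cg, Ordinal ag); apply/and3P; split=> //.
apply/hedgeP; rewrite /= qd xd; split=> // /xq; exact: pos.
Qed.

Theorem theorem5 (g k : nat) (hg : 3 <= g) (hk : 2 <= k) (hkg : k < g)
    (hex : young_exists g k) :
  (exists m : nat, young_complete g k m) <->
  (forall s r : 'I_k, young_node g (Some (s, r)) -> s = r).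
Proof.
split=> [[m [_ adj _ start]] s r ysr|diag].
  case: (eqVneq s r) => // sr.
  (* An off-diagonal node is not [0,0], so completeness gives it an edge from the starting node as
     well as a loop. *)
  have [|l0 /and3P[_ _ /hedgeP[/= e1 e2 _]]] := (start _ ysr).2.
    by move=> /= [s0 r0]; move: sr; rewrite -val_eqE /= s0 r0.
  have [l /and3P[_ _ /hedgeP[/= e3 e4 _]]] := adj _ _ ysr ysr.
  rewrite mul0n addn0 in e1; rewrite addn0 in e2.
  exact/val_inj/(start_loop_diagonal hk (ltn_ord s) (ltn_ord r) e1 e2 e3 e4).
have adj (p q : 'I_k * 'I_k) : young_node g (Some p) ->
    young_node g (Some q) -> young_adj g (Some p) (Some q).
  by move=> yp yq; apply: diagonal_young_adj.
set N := [set p : 'I_k * 'I_k | young_node g (Some p)].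
exists #|N|; split=> // [|p yp].
- set E := [set e | _].
  (* Labels are determined by endpoints, so the edges biject with their endpoint pairs, which fill
     [N] times [N]. *)
  have f_inj : {in E &, injective (fun e : ('I_k * 'I_k) * ylabel g
      * ('I_k * 'I_k) => (e.1.1, e.2))}.
    move=> [[p l] q] [[p' l'] q']; rewrite !inE /=.
    move=> /and3P[_ _ h] /and3P[_ _ h'] [ep eq]; subst p' q'.
    by rewrite (young_edge_inj hk h h').
  rewrite -(card_in_imset f_inj) -mulnn -cardsX; congr #|pred_of_set _|.
  apply/setP=> -[p q]; rewrite !inE /=; apply/imsetP/andP.
    by move=> [[[p' l] q']]; rewrite inE /= => /and3P[yp yq _] [-> ->].
  by move=> [/adj h /h [l yl]]; exists (p, l, q); rewrite ?inE.
- have pd : p.2 = p.1 by case: (p) yp => s r /diag ->.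
  split=> [[l /and3P[_ _ /hedgeP[e1 e2 /(_ erefl)[a0 c0]]]] [p1 p2]|p0].
    (* An edge from the starting node to [0,0] would have [k * c = a] and [c = k * a] with positive
       digits, impossible for [k >= 2]. *)
    move: e1 e2 a0 c0; rewrite p1 p2 muln0 mul0n !addn0 !add0n.
    by move: (l.1 : nat) (l.2 : nat) => c a; nia.
  have p10 : 0 < p.1 by rewrite lt0n; apply/eqP => p1; apply: p0; rewrite pd.
  apply: diagonal_young_adj => //.
  have /andP[hp /existsP[z /andP[pz yz]]] := yp.
  rewrite /young_node [hnode _ _]connect0 /=; apply/existsP; exists z.
  by rewrite pz (connect_trans hp yz).
Qed.
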